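(* For every Hausdorff space $X$ we have $|X|\le(\pi\chi(X)\cdot d(X))^{\mathrm{ot}(X)\cdot\psi_c(X)}$.
   Context: - $d(X)$ is the density of $X$: the smallest infinite cardinal $\kappa$ such that $X$ has a dense subset of cardinality $\le\kappa$. - $\pi\chi(X)$ ($\pi$-character) is the minimal infinite cardinal $\kappa$ such that every $x\in X$ has a local $\pi$-base of cardinality $\le\kappa$, where a family $\mathcal{V}$ of non-empty open subsets of $X$ is a local $\pi$-base at $x$ if every open neighborhood of $x$ contains some $V\in\mathcal{V}$. - $\mathrm{ot}(X)$ (o-tightness) is the smallest infinite cardinal $\kappa$ such that for every family $\mathcal{U}$ of open subsets of $X$ and every $x\in\overline{\bigcup\mathcal{U}}$ there is $\mathcal{V}\subset\mathcal{U}$ with $|\mathcal{V}|\le\kappa$ and $x\in\overline{\bigcup\mathcal{V}}$. - $\psi_c(X)$ (closed pseudocharacter, for Hausdorff $X$) is the smallest infinite cardinal $\kappa$ such that for each $x\in X$ there is a collection $\{V(\eta,x):\eta<\kappa\}$ of open neighborhoods of $x$ with $\bigcap_{\eta<\kappa}\overline{V(\eta,x)}=\{x\}$. *)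

(* Defs.v *)
From mathcomp Require Import all_boot all_order.
From mathcomp Require Import boolp classical_sets functions cardinality.
From mathcomp Require Import topology.

Set Implicit Arguments.
Unset Strict Implicit.
Unset Printing Implicit Defensive.

Local Open Scope classical_set_scope.
Local Open Scope card_scope.

(* Cardinals are represented by types, compared through [#<=] on their full
   sets (existence of an injection).  Products and powers of cardinals are then
   product types and function types. *)

Definition is_least_infinite_cardinal (P : Type -> Prop) (K : Type) : Prop :=
  [/\ infinite_set [set: K], P K &
      forall L : Type, infinite_set [set: L] -> P L -> [set: K] #<= [set: L]].

(* The value [nat] is a junk default, used only when no infinite cardinal
   satisfies [P]; see [least_infinite_cardinalP]. *)
Definition least_infinite_cardinal (P : Type -> Prop) : Type :=
  match pselect (exists K : Type, is_least_infinite_cardinal P K) with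
  | left h => projT1 (cid h)
  | right _ => nat
  end.

Definition density_le (X : topologicalType) (K : Type) : Prop :=
  exists D : set X, dense D /\ D #<= [set: K].

Definition density (X : topologicalType) : Type :=
  least_infinite_cardinal (density_le X).

Definition local_pi_base (X : topologicalType) (x : X) (V : set (set X)) : Prop :=
  (forall A, V A -> open A /\ A !=set0) /\
  (forall U, open_nbhs x U -> exists2 A, V A & A `<=` U).

Definition pi_character_le (X : topologicalType) (K : Type) : Prop :=
  forall x : X, exists V : set (set X), local_pi_base x V /\ V #<= [set: K].

Definition pi_character (X : topologicalType) : Type :=
  least_infinite_cardinal (pi_character_le X).

Definition o_tightness_le (X : topologicalType) (K : Type) : Prop :=
  forall U : set (set X), (forall A, U A -> open A) ->
  forall x : X, closure (\bigcup_(A in U) A) x ->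
  exists V : set (set X),
    [/\ V `<=` U, V #<= [set: K] & closure (\bigcup_(A in V) A) x].

Definition o_tightness (X : topologicalType) : Type :=
  least_infinite_cardinal (o_tightness_le X).

(* [K] itself is the index type of the family of neighborhoods. *)
Definition closed_pseudocharacter_le (X : topologicalType) (K : Type) : Prop :=
  forall x : X, exists V : K -> set X,
    (forall k, open_nbhs x (V k)) /\ \bigcap_k closure (V k) = [set x].

(* Meaningful for Hausdorff spaces only: otherwise no [K] need qualify. *)
Definition closed_pseudocharacter (X : topologicalType) : Type :=
  least_infinite_cardinal (closed_pseudocharacter_le X).

(* The remaining lemmas show that the minima in these definitions are attained
   (for the closed pseudocharacter, when the space is Hausdorff). *)

Lemma inj_card_leT (T U : Type) (f : T -> U) :
  injective f -> [set: T] #<= [set: U].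
Proof.
move=> fI.
have [g] : $|{injfun [set: T] >-> [set: U]}|.
  by apply/injfunPex; exists f => // x y _ _; exact: fI.
exact: inj_card_le g.
Qed.

Lemma card_leT_inj (T U : Type) :
  [set: T] #<= [set: U] -> exists f : T -> U, injective f.
Proof.
move=> /card_leP[g].
exists (fun x => \val (g (SigSub (mem_set (I : [set: T] x))))) => x y /val_inj.
by move=> /(@inj _ _ _ g) - /(_ (mem_set I) (mem_set I)) [].
Qed.

Lemma infinite_nat_sum (T : Type) : infinite_set [set: (nat + T)%type].
Proof.
move=> fin; apply: infinite_nat; apply: card_le_finite fin.
by apply: (@inj_card_leT nat (nat + T) inl) => m n [].
Qed.

(* Zorn's lemma on the sets of elements of the product on which every
   projection is injective. *)
Lemma least_card_exists (I : Type) (C : I -> Type) (i0 : I) :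
  exists i, forall j, [set: C i] #<= [set: C j].
Proof.
pose P (Y : set (forall i, C i)) :=
  forall i f g, Y f -> Y g -> f i = g i -> f = g.
have [|Y [PY Ymax]] := @Zorn_bigcup _ P.
  move=> F FP totF i f g [A FA Af] [B FB Bg].
  have [AB|BA] := totF _ _ FA FB.
  - by apply: (FP _ FB) => //; exact: AB.
  - by apply: (FP _ FA) => //; exact: BA.
have [i iS] : exists i, forall c : C i, exists2 f, Y f & f i = c.
  apply/not_existsP => nS.
  have hS i : {c : C i | forall f, Y f -> f i <> c}.
    apply: cid; have /existsNP[c nc] := nS i.
    by exists c => f Yf fc; apply: nc; exists f.
  pose h i := projT1 (hS i).
  have hY i f : Y f -> f i <> h i by exact: (projT2 (hS i)).
  apply: (Ymax (Y `|` [set h])).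
    split; first by move=> f Yf; left.
    by move=> /(_ h (or_intror erefl)) Yh; exact: (hY i0 h Yh).
  move=> i f g [Yf|->] [Yg|->] // e.
  - exact: PY e.
  - by case: (hY i f Yf e).
  - by case: (hY i g Yg); rewrite e.
exists i => j.
have /choice[s sP] : forall c : C i, exists f, Y f /\ f i = c.
  by move=> c; have [f Yf fc] := iS c; exists f.
apply: (@inj_card_leT _ _ (fun c => s c j)) => c d e.
have [[Yc <-] [Yd <-]] := (sP c, sP d).
by rewrite (PY j _ _ Yc Yd e).
Qed.

Lemma card_le_total (T U : Type) :
  [set: T] #<= [set: U] \/ [set: U] #<= [set: T].
Proof.
have [[] le] := @least_card_exists bool (fun b => if b then T else U) true.
- by left; exact: le false.
- by right; exact: le true.
Qed.

Lemma least_infinite_cardinalP (P : Type -> Prop) (K : Type) :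
  infinite_set [set: K] -> P K ->
  is_least_infinite_cardinal P (least_infinite_cardinal P).
Proof.
move=> Kinf PK.
rewrite /least_infinite_cardinal; case: pselect => [h|]; first by case: cid.
case.
pose Q (L : Type) := infinite_set [set: L] /\ P L.
pose I := {S : set K | exists L, Q L /\ [set: L] #= S}.
have KI : exists L, Q L /\ [set: L] #= [set: K] by exists K.
have [[S [L [[Linf PL] LS]]] Sle] :=
  @least_card_exists I (fun i => set_type (sval i)) (exist _ [set: K] KI).
exists L; split => // M Minf PM.
rewrite (card_le_eql LS).
have [KM|MK] := card_le_total K M.
  exact: card_le_trans (card_leT S) KM.
have [f fI] := card_leT_inj MK.
have MS : [set: M] #= range f.
  by apply/card_esym/inj_card_eq => x y _ _; exact: fI.
have MI : exists L, Q L /\ [set: L] #= range f by exists M.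
have := Sle (exist _ (range f) MI).
rewrite /= (card_le_eql (card_setT S)) (card_le_eqr (card_setT _)).
by rewrite (card_le_eqr MS).
Qed.

Lemma density_least (X : topologicalType) :
  is_least_infinite_cardinal (density_le X) (density X).
Proof.
apply: (@least_infinite_cardinalP _ (nat + X)%type).
  exact: infinite_nat_sum.
exists setT; split; first by move=> O [x Ox] _; exists x.
by apply: (@inj_card_leT X (nat + X) inr) => x y [].
Qed.

Lemma set_card_le_nat_sum (T : Type) (V : set T) :
  V #<= [set: (nat + T)%type].
Proof.
apply: card_le_trans (card_leT V) _.
by apply: (@inj_card_leT T (nat + T) inr) => x y [].
Qed.

Lemma pi_character_least (X : topologicalType) :
  is_least_infinite_cardinal (pi_character_le X) (pi_character X).
Proof.
apply: (@least_infinite_cardinalP _ (nat + set X)%type).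
  exact: infinite_nat_sum.
move=> x; exists (open_nbhs x); split; last exact: set_card_le_nat_sum.
split; last by move=> U Ux; exists U.
by move=> A [oA Ax]; split=> //; exists x.
Qed.

Lemma o_tightness_least (X : topologicalType) :
  is_least_infinite_cardinal (o_tightness_le X) (o_tightness X).
Proof.
apply: (@least_infinite_cardinalP _ (nat + set X)%type).
  exact: infinite_nat_sum.
move=> U _ x Ux; exists U; split=> //; exact: set_card_le_nat_sum.
Qed.

Lemma closed_pseudocharacter_least (X : topologicalType) :
  hausdorff_space X ->
  is_least_infinite_cardinal (closed_pseudocharacter_le X) (closed_pseudocharacter X).
Proof.
move=> hX; apply: (@least_infinite_cardinalP _ (nat + set X)%type).
  exact: infinite_nat_sum.
move=> x.
exists (fun k => if k is inr U then
                   if `[< open_nbhs x U >] then U else setT else setT).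
split.
  case=> [?|U]; first exact: open_nbhsT.
  by case: asboolP => // _; exact: open_nbhsT.
apply/seteqP; split=> [y yV|_ -> k _]; last first.
  apply: subset_closure; case: k => [//|U].
  by case: asboolP => [[]|].
apply/esym/hX => A B xA yB.
have [U Ux UA] : exists2 U, open_nbhs x U & U `<=` A.
  by move: xA; rewrite nbhsE => -[U]; exists U.
have := yV (inr U) I; case: asboolP => // _ /(_ _ yB)[z [Uz Bz]].
by exists z; split=> //; exact: UA.
Qed.

(* Main.v *)
Require Import Defs.
From mathcomp Require Import all_boot all_order.
From mathcomp Require Import boolp classical_sets functions cardinality.
From mathcomp Require Import topology.

Local Open Scope classical_set_scope.
Local Open Scope card_scope.

(** Choosing a local pi-base at each point of a dense set and taking the union
    yields a global pi-base [B] with at most [pi_character X * density X]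
    members ([exists_pi_base]).  If [V] is an open neighborhood
    of a point [x], then [x] adheres to the union of the members of [B]
    contained in [V], and o-tightness thins these out to a subfamily indexed by
    [o_tightness X] with the same property ([o_tight_pi_subfamily]).  Doing this for each member of a family
    [V(k, x)] with [\bigcap_k closure (V k x) = [set x]] attaches to [x] a
    function from [o_tightness X * closed_pseudocharacter X] to [B].  This
    function determines [x], because the closures of the unions of the
    subfamilies contain [x] and lie inside the closures of the [V(k, x)]
    ([inj_code_of_pi_base]).

    All families are indexed by the types that stand for the cardinals, so the
    bound is an explicit injection and no cardinal arithmetic is involved. *)

Lemma card_leT_range {K T : Type} {A : set T} :
  A !=set0 -> A #<= [set: K] -> exists f : K -> T, range f = A.
Proof.
move=> [a Aa] /pfcard_geP[A0|[f]]; first by rewrite A0 in Aa.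
by exists f; rewrite image_eq.
Qed.

(** The map [g] enumerates, possibly with repetitions, a pi-base of [X]: a
    family of nonempty open sets, one of which lies inside any given nonempty
    open set. *)
Definition pi_base_enum {X : topologicalType} {C : Type} (g : C -> set X) :=
  (forall c, open (g c) /\ g c !=set0) /\
  (forall O, open O -> O !=set0 -> exists c, g c `<=` O).

Lemma exists_pi_base {X : topologicalType} {P D : Type} (x0 : X) :
  pi_character_le X P -> density_le X D ->
  exists g : P * D -> set X, pi_base_enum g.
Proof.
move=> piP [S [Sdense SD]].
have [|e eS] := card_leT_range _ SD.
  by have [x [_ Sx]] := Sdense setT (ex_intro _ x0 I) openT; exists x.
have /choice[b bP] : forall x : X, exists b : P -> set X,
    local_pi_base x (range b).
  move=> x; have [V [piV VP]] := piP x.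
  have [|b bV] := card_leT_range _ VP; last by exists b; rewrite bV.
  by have [A VA _] := piV.2 _ (open_nbhsT x); exists A.
exists (fun c => b (e c.2) c.1); split=> [c|O Oopen O0].
  by apply: (bP (e c.2)).1; exists c.1.
have [x [Ox]] := Sdense O O0 Oopen; rewrite -eS => -[d _ edx].
have [_ /(_ O) [//|_ [p _ <-] bO]] := bP x.
by exists (p, d); rewrite /= edx.
Qed.

Lemma closure_bigcup_pi_base {X : topologicalType} {C : Type}
    {g : C -> set X} {x : X} {V : set X} :
  pi_base_enum g -> open_nbhs x V ->
  closure (\bigcup_(A in [set A | range g A /\ A `<=` V]) A) x.
Proof.
move=> [gopen gbase] [Vopen Vx] N Nx.
have [| |c gNV] := gbase (N° `&` V).
- by apply: openI => //; exact: open_interior.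
- by exists x; split=> //; exact: nbhs_singleton (nbhs_interior Nx).
have [_ [y gy]] := gopen c.
have [Ny _] := gNV _ gy.
exists y; split; last exact: interior_subset.
by exists (g c) => //; split; [exists c | move=> z /gNV[]].
Qed.

Lemma o_tight_pi_subfamily {X : topologicalType} {T C : Type}
    {g : C -> set X} {x : X} {V : set X} :
  o_tightness_le X T -> pi_base_enum g -> open_nbhs x V ->
  exists f : T -> C,
    (forall t, g (f t) `<=` V) /\ closure (\bigcup_t g (f t)) x.
Proof.
move=> otT gP xV.
have [|W [WU WT xW]] := otT _ _ x (closure_bigcup_pi_base gP xV).
  by move=> A [[c _ <-] _]; exact: (gP.1 c).1.
(* A point adherent to the union of W witnesses that W is nonempty, so W can be
   enumerated by the whole of T. *)
have [|w wW] := card_leT_range _ WT.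
  by have [y [[A WA _] _]] := xW setT filterT; exists A.
have wU t : range g (w t) /\ w t `<=` V by apply: WU; rewrite -wW; exists t.
have /choice[f fw] : forall t, exists c, g c = w t.
  by move=> t; have [[c _ gc] _] := wU t; exists c.
exists f; split=> [t|]; first by rewrite fw; exact: (wU t).2.
by apply: closureS xW => y [A]; rewrite -wW => -[t _ <-] wy; exists t; rewrite ?fw.
Qed.

Lemma inj_code_of_pi_base {X : topologicalType} {T K C : Type}
    {g : C -> set X} :
  o_tightness_le X T -> closed_pseudocharacter_le X K -> pi_base_enum g ->
  exists F : X -> (T * K -> C), injective F.
Proof.
move=> otT psiK gP.
have /choice[V VP] := psiK.
have /choice[f fP] : forall xk : X * K, exists f : T -> C,
    (forall t, g (f t) `<=` V xk.1 xk.2) /\ closure (\bigcup_t g (f t)) xk.1.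
  move=> [x k]; apply: o_tight_pi_subfamily otT gP _.
  by have [Vx _] := VP x; exact: Vx.
exists (fun x tk => f (x, tk.2) tk.1) => x y Fxy.
have [_ Vy] := VP y.
suff : (\bigcap_k closure (V y k)) x by rewrite Vy.
move=> k _; have [_ /=] := fP (x, k); apply: closureS => z [t _].
rewrite (congr1 (fun F => F (t, k)) Fxy : f (x, k) t = f (y, k) t).
by have [fV _] := fP (y, k); exact: fV.
Qed.

Theorem corollary5p9 (X : topologicalType) (hX : hausdorff_space X) :
  [set: X] #<=
  [set: (o_tightness X * closed_pseudocharacter X) ->
        (pi_character X * density X)].
Proof.
have [[x0 _]|X0] := pselect ([set: X] !=set0); last first.
  have -> : [set: X] = set0 by apply/eqP/negPn/negP => /set0P.
  exact: card_ge0.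
have [_ piX _] := pi_character_least X.
have [_ dX _] := density_least X.
have [_ otX _] := o_tightness_least X.
have [_ psiX _] := closed_pseudocharacter_least hX.
have [g gP] := exists_pi_base x0 piX dX.
have [F FI] := inj_code_of_pi_base otX psiX gP.
exact: inj_card_leT FI.
Qed.
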